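(* Let $m<n$ be positive integers and let $f:\mathbb{R}^n\to\mathbb{R}$ and $g:\mathbb{R}^n\to\mathbb{R}^m$ be twice continuously differentiable functions. Let $x^\ast\in\mathbb{R}^n$ satisfy $g(x^\ast)=0$ and suppose that $x^\ast$ is a regular point, i.e. the Jacobian matrix $Dg(x^\ast)$ has full rank $m$. Suppose that there is $\lambda^\ast\in\mathbb{R}^m$ such that the KKT conditions $$\nabla f(x^\ast)+\nabla g(x^\ast)\,\lambda^\ast=0,\qquad g(x^\ast)=0$$ hold, and that the matrix $$H^\ast=D^2f(x^\ast)+\sum_{i=1}^m\lambda_i^\ast\,D^2g_i(x^\ast)$$ is positive definite on $\mathcal{T}_{x^\ast}=\{\tau\in\mathbb{R}^n: Dg(x^\ast)\,\tau=0\}$, that is, $\langle H^\ast\tau,\tau\rangle>0$ for every nonzero $\tau\in\mathcal{T}_{x^\ast}$. Then there exists $r>0$ such that, given $x^{(0)}\in\bar B_r(x^\ast)$, the sequence of iterates defined by $$x^{(k+1)}=x^{(k)}-\eta\,\nabla f(x^{(k)})-\nabla g(x^{(k)})\,\lambda^{(k)},\qquad k=0,1,2,\dots,$$ with $\lambda^{(k)}\in\mathbb{R}^m$ determined by the linear system $$Dg(x^{(k)})\,\nabla g(x^{(k)})\,\lambda^{(k)}=g(x^{(k)})-\eta\,Dg(x^{(k)})\,\nabla f(x^{(k)}),$$ converges linearly to $x^\ast$ for all sufficiently small step lengths $\eta>0$.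
   Context: $Dg(x)$ denotes the $m\times n$ Jacobian matrix of $g=(g_1,\dots,g_m)$ at $x$, and $\nabla g(x)$ denotes its transpose (an $n\times m$ matrix, whose columns are the gradients $\nabla g_i(x)$). $\nabla f$ is the usual gradient (column vector) of the scalar function $f$, and $D^2f$, $D^2g_i$ are Hessian matrices. $\langle\cdot,\cdot\rangle$ is the usual dot product in $\mathbb{R}^n$. $\bar B_r(x^\ast)=\{x\in\mathbb{R}^n:\|x-x^\ast\|_2\le r\}$ is the closed Euclidean ball. A sequence $x^{(k)}$ converges linearly to $x^\ast$ if there is a constant $L\in(0,1)$ such that $\|x^{(k)}-x^\ast\|=O(L^k)$ as $k\to\infty$. *)

(* Defs.v *)
From HB Require Import structures.
From mathcomp Require Import all_boot all_order all_algebra.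
From mathcomp Require Import all_classical all_reals all_analysis.

Set Implicit Arguments.
Unset Strict Implicit.
Unset Printing Implicit Defensive.

Import Order.TTheory GRing.Theory Num.Theory.
Import numFieldNormedType.Exports.

Local Open Scope classical_set_scope.
Local Open Scope ring_scope.

(* Vectors of R^n are columns. The norm that MathComp-Analysis puts on
   matrices is the maximum norm; it is used only through the topology and the
   differentials it induces. Euclidean lengths are measured with enorm. *)
Definition dot (R : realType) (n : nat) (u v : 'cV[R]_n) : R :=
  \sum_(i < n) u i 0 * v i 0.

Definition enorm (R : realType) (n : nat) (u : 'cV[R]_n) : R :=
  Num.sqrt (dot u u).

Definition partial (R : realType) (n : nat) (W : normedModType R)
    (j : 'I_n) (F : 'cV[R]_n -> W) : 'cV[R]_n -> W :=
  fun x => 'D_(delta_mx j 0) F x.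

Definition continuously_differentiable (R : realType) (n : nat)
    (W : normedModType R) (F : 'cV[R]_n -> W) : Prop :=
  (forall x, differentiable F x) /\ (forall j, continuous (partial j F)).

Definition twice_continuously_differentiable (R : realType) (n : nat)
    (W : normedModType R) (F : 'cV[R]_n -> W) : Prop :=
  continuously_differentiable F /\
  (forall j, continuously_differentiable (partial j F)).

Definition grad (R : realType) (n : nat) (f : 'cV[R]_n -> R^o)
    (x : 'cV[R]_n) : 'cV[R]_n :=
  \col_j partial j f x.

Definition hess (R : realType) (n : nat) (f : 'cV[R]_n -> R^o)
    (x : 'cV[R]_n) : 'M[R]_n :=
  \matrix_(i, j) partial i (partial j f) x.

Definition component (R : realType) (n m : nat) (g : 'cV[R]_n -> 'cV[R]_m)
    (i : 'I_m) : 'cV[R]_n -> R^o :=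
  fun x => g x i 0.

(* The Jacobian 'J of the library is restricted to maps between row vectors
   and is the transpose of this one. *)
Definition jac (R : realType) (n m : nat) (g : 'cV[R]_n -> 'cV[R]_m)
    (x : 'cV[R]_n) : 'M[R]_(m, n) :=
  \matrix_(i, j) partial j (component g i) x.

Definition nabla (R : realType) (n m : nat) (g : 'cV[R]_n -> 'cV[R]_m)
    (x : 'cV[R]_n) : 'M[R]_(n, m) :=
  (jac g x)^T.

Definition lagrangian_hess (R : realType) (n m : nat) (f : 'cV[R]_n -> R^o)
    (g : 'cV[R]_n -> 'cV[R]_m) (lam : 'cV[R]_m) (x : 'cV[R]_n) : 'M[R]_n :=
  hess f x + \sum_(i < m) lam i 0 *: hess (component g i) x.

Definition multiplier_system (R : realType) (n m : nat) (f : 'cV[R]_n -> R^o)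
    (g : 'cV[R]_n -> 'cV[R]_m) (eta : R) (x : 'cV[R]_n) (lam : 'cV[R]_m) :
    Prop :=
  jac g x *m nabla g x *m lam = g x - eta *: (jac g x *m grad f x).

(* [unique] expresses that the linear system determines lam k; hence x and lam
   are the only sequences satisfying the recursion from x0. *)
Definition iterates (R : realType) (n m : nat) (f : 'cV[R]_n -> R^o)
    (g : 'cV[R]_n -> 'cV[R]_m) (eta : R) (x0 : 'cV[R]_n)
    (x : nat -> 'cV[R]_n) (lam : nat -> 'cV[R]_m) : Prop :=
  [/\ x 0%N = x0,
      forall k, unique (multiplier_system f g eta (x k)) (lam k) &
      forall k, x k.+1 = x k - eta *: grad f (x k) - nabla g (x k) *m lam k].

Definition converges_linearly (R : realType) (n : nat) (x : nat -> 'cV[R]_n)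
    (xs : 'cV[R]_n) : Prop :=
  exists L : R, 0 < L < 1 /\
    (fun k => enorm (x k - xs) : R^o) =O_\oo (fun k => L ^+ k : R^o).

(* Main.v *)
(* Put v = x - xs and let phi be the gradient of the Lagrangian at lams. Since
   the tangent projection P(x) kills the columns of nabla g x, one step reads
   x+ = x - eta P(x) phi(x) - S(x) g(x), with S(x) the right pseudo-inverse of
   the Jacobian A(x), and phi(x) = H^T v + o(|v|). Coercivity of H on the kernel
   of A(xs), together with A(xs) v = g(x) + o(|v|), gives
     |x+ - xs| <= (1 - eta c + eta o(1)) |v| + K |g(x)|.
   The displacement d = x+ - x satisfies A(x) d = - g(x), so strict
   differentiability of g at xs gives
     |g(x+)| <= o(1) |d| <= o(1) (eta |v| + |g(x)|).
   Hence |x - xs| + M |g(x)| contracts by the factor 1 - eta c / 2 for M large.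
   Every o(1) carrying |v| comes with a factor eta, which is why the radius can
   be chosen independently of the step length. *)

Require Import Defs.
From mathcomp Require Import all_boot all_order all_algebra.
From mathcomp Require Import all_classical all_reals all_analysis.
From mathcomp Require Import ring lra.
Import Order.TTheory GRing.Theory Num.Theory.
Import numFieldNormedType.Exports.
Set Implicit Arguments.
Unset Strict Implicit.
Local Open Scope classical_set_scope.
Local Open Scope ring_scope.

(** * The Euclidean norm *)

Lemma dotE (R : realType) (n : nat) (u v : 'cV[R]_n) :
  dot u v = (u^T *m v) 0 0.
Proof. by rewrite mxE; apply: eq_bigr => i _; rewrite mxE. Qed.

Lemma dotC (R : realType) (n : nat) (u v : 'cV[R]_n) : dot u v = dot v u.
Proof. by apply: eq_bigr => i _; rewrite mulrC. Qed.

Lemma dotDr (R : realType) (n : nat) (u v w : 'cV[R]_n) :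
  dot u (v + w) = dot u v + dot u w.
Proof. by rewrite !dotE mulmxDr mxE. Qed.

Lemma dotZr (R : realType) (n : nat) (a : R) (u v : 'cV[R]_n) :
  dot u (a *: v) = a * dot u v.
Proof. by rewrite !dotE -scalemxAr mxE. Qed.

Lemma dot_mull (R : realType) (n p : nat) (M : 'M[R]_(n, p)) (u : 'cV[R]_p)
    (v : 'cV[R]_n) : dot (M *m u) v = dot u (M^T *m v).
Proof. by rewrite !dotE trmx_mul mulmxA. Qed.

Lemma dot_ge0 (R : realType) (n : nat) (u : 'cV[R]_n) : 0 <= dot u u.
Proof. by apply: sumr_ge0 => i _; rewrite -expr2 sqr_ge0. Qed.

Lemma dot_eq0 (R : realType) (n : nat) (u : 'cV[R]_n) :
  (dot u u == 0) = (u == 0).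
Proof.
apply/idP/eqP => [|->]; last by rewrite dotE mulmx0 mxE.
rewrite psumr_eq0 => [/allP u0|i _]; last by rewrite -expr2 sqr_ge0.
apply/colP => i; rewrite mxE; apply/eqP.
by have := u0 i (mem_index_enum i); rewrite mulf_eq0 orbb.
Qed.

Lemma enorm_ge0 (R : realType) (n : nat) (u : 'cV[R]_n) : 0 <= enorm u.
Proof. exact: sqrtr_ge0. Qed.

Lemma sqr_enorm (R : realType) (n : nat) (u : 'cV[R]_n) :
  enorm u ^+ 2 = dot u u.
Proof. by rewrite sqr_sqrtr ?dot_ge0. Qed.

Lemma enorm_eq0 (R : realType) (n : nat) (u : 'cV[R]_n) :
  (enorm u == 0) = (u == 0).
Proof. by rewrite -sqrf_eq0 sqr_enorm dot_eq0. Qed.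

Lemma enorm0 (R : realType) (n : nat) : enorm (0 : 'cV[R]_n) = 0.
Proof. by apply/eqP; rewrite enorm_eq0. Qed.

Lemma enormZ (R : realType) (n : nat) (a : R) (u : 'cV[R]_n) :
  enorm (a *: u) = `|a| * enorm u.
Proof.
by rewrite /enorm dotZr dotC dotZr mulrA -expr2 sqrtrM ?sqr_ge0 // sqrtr_sqr.
Qed.

Lemma enormN (R : realType) (n : nat) (u : 'cV[R]_n) : enorm (- u) = enorm u.
Proof. by rewrite -scaleN1r enormZ normrN1 mul1r. Qed.

Lemma sqr_enormD (R : realType) (n : nat) (u v : 'cV[R]_n) :
  enorm (u + v) ^+ 2 = enorm u ^+ 2 + 2 * dot u v + enorm v ^+ 2.
Proof.
by rewrite !sqr_enorm dotDr [dot _ u]dotC [dot _ v]dotC !dotDr (dotC v u); ring.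
Qed.

(** The squared length of |v| u - |u| v equals 2 |u| |v| (|u| |v| - <u, v>). Dividing by |u| |v|
    requires the zero vectors to be treated first. *)
Lemma dot_le_enorm (R : realType) (n : nat) (u v : 'cV[R]_n) :
  dot u v <= enorm u * enorm v.
Proof.
have [->|v0] := eqVneq v 0; first by rewrite dotE mulmx0 mxE enorm0 mulr0.
have [->|u0] := eqVneq u 0.
  by rewrite dotC dotE mulmx0 mxE enorm0 mul0r.
have pu : 0 < enorm u by rewrite lt0r enorm_eq0 u0 enorm_ge0.
have pv : 0 < enorm v by rewrite lt0r enorm_eq0 v0 enorm_ge0.
have := sqr_ge0 (enorm (enorm v *: u + (- enorm u) *: v)).
rewrite sqr_enormD !enormZ normrN !ger0_norm ?enorm_ge0 // dotZr dotC dotZr.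
rewrite (dotC v u) => h.
have {h} : 0 <= (enorm u * enorm v - dot u v) * (2 * (enorm u * enorm v)).
  by apply: le_trans h _; rewrite le_eqVlt; apply/orP; left; apply/eqP; ring.
by rewrite pmulr_lge0 ?subr_ge0 // mulr_gt0 // mulr_gt0.
Qed.

Lemma enormD (R : realType) (n : nat) (u v : 'cV[R]_n) :
  enorm (u + v) <= enorm u + enorm v.
Proof.
rewrite -(ler_pXn2r (ltn0Sn 1)) ?nnegrE ?addr_ge0 ?enorm_ge0 //.
rewrite sqr_enormD; have := dot_le_enorm u v; nra.
Qed.

Lemma enormB (R : realType) (n : nat) (u v : 'cV[R]_n) :
  enorm (u - v) <= enorm u + enorm v.
Proof. by rewrite -(enormN v) enormD. Qed.

Lemma coord_le_enorm (R : realType) (n : nat) (u : 'cV[R]_n) (i : 'I_n) :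
  `|u i 0| <= enorm u.
Proof.
rewrite -sqrtr_sqr ler_wsqrtr // /dot (bigD1 i) //= -expr2 lerDl.
by apply: sumr_ge0 => j _; rewrite -expr2 sqr_ge0.
Qed.

Lemma enorm_le_coord (R : realType) (n : nat) (u : 'cV[R]_n) (e : R) :
  (forall i, `|u i 0| <= e) -> enorm u <= n%:R * e.
Proof.
move=> ue.
(* For n = 0 the hypothesis is vacuous and [e] may be negative; both sides are then 0. *)
have [n0|n_gt0] := posnP n.
  suff -> : enorm u = 0 by rewrite n0 mul0r.
  by rewrite /enorm /dot; move: u {ue}; rewrite n0 => u; rewrite big_ord0 sqrtr0.
have e0 : 0 <= e by apply: le_trans (ue (Ordinal n_gt0)).
rewrite -(ler_pXn2r (ltn0Sn 1)) ?nnegrE ?mulr_ge0 ?enorm_ge0 // sqr_enorm.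
rewrite exprMn -natrX.
apply: (@le_trans _ _ (\sum_(i < n) e ^+ 2)).
  by apply: ler_sum => i _; rewrite -expr2 -real_normK ?num_real // lerXn2r ?nnegrE.
rewrite sumr_const card_ord -[leLHS]mulr_natl ler_wpM2r ?sqr_ge0 // ler_nat.
by rewrite -{1}(expn1 n) leq_pexp2l.
Qed.

Lemma mulmx_col_le (R : realType) (p n : nat) (M : 'M[R]_(p, n)) (u : 'cV[R]_n)
    (e : R) : (forall i j, `|M i j| <= e) ->
  enorm (M *m u) <= p%:R * (n%:R * (e * enorm u)).
Proof.
move=> Me; apply: enorm_le_coord => i; rewrite mxE.
apply: le_trans (ler_norm_sum _ _ _) _.
apply: (@le_trans _ _ (\sum_(j < n) e * enorm u)).
  by apply: ler_sum => j _; rewrite normrM ler_pM // coord_le_enorm.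
by rewrite sumr_const card_ord mulr_natl.
Qed.

Lemma mulmx_bounded (R : realType) (p n : nat) (M : 'M[R]_(p, n)) :
  exists2 C : R, 0 <= C & forall u, enorm (M *m u) <= C * enorm u.
Proof.
exists (p%:R * (n%:R * `|M|)) => [|u]; first by rewrite !mulr_ge0.
rewrite -!mulrA; apply: mulmx_col_le => i j.
rewrite [leRHS]mx_normrE.
exact: (@le_bigmax _ _ _ _ (fun ij : 'I_p * 'I_n => `|M ij.1 ij.2|) (i, j)).
Qed.

(** * Limits of matrices *)

Lemma cvg_bigD (R : realType) (T I : Type) (F : set_system T) (FF : Filter F)
    (r : seq I) (f : I -> T -> R) (l : I -> R) :
  (forall i, f i x @[x --> F] --> l i) ->
  (\sum_(i <- r) f i x) @[x --> F] --> \sum_(i <- r) l i.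
Proof.
move=> fl; elim: r => [|i r IH].
  by under eq_fun do rewrite big_nil; rewrite big_nil; exact: cvg_cst.
by under eq_fun do rewrite big_cons; rewrite big_cons; exact: cvgD.
Qed.

Lemma cvg_bigM (R : realType) (T I : Type) (F : set_system T) (FF : Filter F)
    (r : seq I) (f : I -> T -> R) (l : I -> R) :
  (forall i, f i x @[x --> F] --> l i) ->
  (\prod_(i <- r) f i x) @[x --> F] --> \prod_(i <- r) l i.
Proof.
move=> fl; elim: r => [|i r IH].
  by under eq_fun do rewrite big_nil; rewrite big_nil; exact: cvg_cst.
by under eq_fun do rewrite big_cons; rewrite big_cons; exact: cvgM.
Qed.

Section MatrixLimits.
Context {R : realType} {T : Type} {F : set_system T} {FF : Filter F}.

Lemma cvg_mx (p n : nat) (M : T -> 'M[R]_(p, n)) (L : 'M[R]_(p, n)) :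
  (forall i j, M x i j @[x --> F] --> L i j) -> M x @[x --> F] --> L.
Proof.
move=> ML; apply/cvg_ballP => e e0.
have : \forall x \near F, forall i j, ball (L i j) e (M x i j).
apply: filter_forall => i; apply: filter_forall => j.
  have /cvg_ballP := ML i j; exact.
by apply: filterS => x Mx; rewrite /ball /= /mx_ball.
Qed.

Lemma cvg_coord (p n : nat) (M : T -> 'M[R]_(p, n)) (L : 'M[R]_(p, n)) i j :
  M x @[x --> F] --> L -> M x i j @[x --> F] --> L i j.
Proof.
move=> ML.
exact: (@continuous_cvg T _ _ F FF M (fun N : 'M[R]_(p, n) => N i j) L
  (@coord_continuous R p n i j L) ML).
Qed.

Lemma cvg_trmx (p n : nat) (M : T -> 'M[R]_(p, n)) (L : 'M[R]_(p, n)) :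
  M x @[x --> F] --> L -> (M x)^T @[x --> F] --> L^T.
Proof.
move=> ML; apply: cvg_mx => i j; under eq_fun do rewrite mxE.
by rewrite mxE; exact: cvg_coord.
Qed.

Lemma cvg_mulmx (p n q : nat) (M : T -> 'M[R]_(p, n)) (L : 'M[R]_(p, n))
    (N : T -> 'M[R]_(n, q)) (K : 'M[R]_(n, q)) :
  M x @[x --> F] --> L -> N x @[x --> F] --> K ->
  M x *m N x @[x --> F] --> L *m K.
Proof.
move=> ML NK; apply: cvg_mx => i j; under eq_fun do rewrite mxE.
by rewrite mxE; apply: cvg_bigD => k; apply: cvgM; exact: cvg_coord.
Qed.

Lemma cvg_det (n : nat) (M : T -> 'M[R]_n) (L : 'M[R]_n) :
  M x @[x --> F] --> L -> \det (M x) @[x --> F] --> \det L.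
Proof.
move=> ML; apply: cvg_bigD => s; apply: cvgM; first exact: cvg_cst.
by apply: cvg_bigM => i; exact: cvg_coord.
Qed.

Lemma near_unitmx (n : nat) (M : T -> 'M[R]_n) (L : 'M[R]_n) :
  L \in unitmx -> M x @[x --> F] --> L -> \forall x \near F, M x \in unitmx.
Proof.
rewrite unitmxE unitfE => L0 /cvg_det/cvgr_neq0 /(_ L0).
by apply: filterS => x; rewrite unitmxE unitfE.
Qed.

(** The adjugate formula is continuous where the determinant is nonzero. [invmx] is given by it on
    invertible matrices, hence the passage through an eventual equality. *)
Lemma cvg_invmx (n : nat) (M : T -> 'M[R]_n) (L : 'M[R]_n) :
  L \in unitmx -> M x @[x --> F] --> L -> invmx (M x) @[x --> F] --> invmx L.
Proof.
move=> Lu ML.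
have -> : invmx L = (\det L)^-1 *: \adj L by rewrite /invmx Lu.
have near_eq : {near F, (fun x => (\det (M x))^-1 *: \adj (M x)) =1
    (fun x => invmx (M x))}.
  by apply: filterS (near_unitmx Lu ML) => x; rewrite /invmx => ->.
apply: cvg_trans (near_eq_cvg near_eq) _.
apply: cvgZ.
  by apply: cvgV; [rewrite -unitfE -unitmxE|exact: cvg_det].
apply: cvg_mx => i j; under eq_fun do rewrite mxE.
rewrite mxE; apply: cvgM; first exact: cvg_cst.
apply: cvg_det; apply: cvg_mx => k l; under eq_fun do rewrite !mxE.
by rewrite !mxE; exact: cvg_coord.
Qed.

(** Turns entrywise convergence of matrices into closeness as operators for the Euclidean length,
    uniformly in [u]. *)
Lemma near_mulmx_le (p n : nat) (M : T -> 'M[R]_(p, n)) (L : 'M[R]_(p, n))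
    (e : R) : 0 < e -> M x @[x --> F] --> L ->
  \forall x \near F, forall u, enorm ((M x - L) *m u) <= e * enorm u.
Proof.
(* The summand 1 keeps [k] positive when p or n is 0. *)
move=> e0 ML; pose k : R := p%:R * n%:R + 1.
have k0 : 0 < k by rewrite ltr_wpDl // mulr_ge0.
have : \forall x \near F, forall i j, `|L i j - M x i j| <= e / k.
  apply: filter_forall => i; apply: filter_forall => j.
  have /cvgr_dist_le : M x i j @[x --> F] --> L i j by exact: cvg_coord.
  by apply; rewrite divr_gt0.
apply: filterS => x Mx u.
have /(mulmx_col_le u) : forall i j, `|(M x - L) i j| <= e / k.
  by move=> i j; rewrite !mxE distrC.
move/le_trans; apply.
rewrite !mulrA ler_wpM2r ?enorm_ge0 // ler_pdivrMr // [leRHS]mulrC.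
by rewrite ler_wpM2r ?ltW // /k ltrDl.
Qed.

End MatrixLimits.

(** * Strict differentiability *)

Lemma norm_le_enorm (R : realType) (n : nat) (u : 'cV[R]_n) : `|u| <= enorm u.
Proof.
rewrite [leLHS]mx_normrE; apply: bigmax_le => [|[i j] _ /=].
  exact: enorm_ge0.
by rewrite (ord1 j) coord_le_enorm.
Qed.

(** Small Euclidean balls lie in max-norm balls. Quantifying over all small radii lets finitely many
    such conditions be intersected before one radius is picked. *)
Lemma near_enorm_ball (R : realType) (n : nat) (a : 'cV[R]_n)
    (P : 'cV[R]_n -> Prop) : (\forall x \near a, P x) ->
  \forall r \near (0 : R)^'+, forall x, enorm (x - a) <= r -> P x.
Proof.
move=> /nbhs_ballP[e /= e0 eP]; near=> r => x xr.
apply: eP; rewrite -ball_normE /= distrC.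
apply: le_lt_trans (norm_le_enorm _) _; apply: le_lt_trans xr _.
by near: r; exact: nbhs_right_lt.
Unshelve. all: by end_near. Qed.

Lemma derive_grad (R : realType) (n : nat) (h : 'cV[R]_n -> R^o)
    (x d : 'cV[R]_n) :
  differentiable h x -> 'D_d h x = dot (grad h x) d.
Proof.
move=> dh; rewrite deriveE // {1}[d]matrix_sum_delta linear_sum.
apply: eq_bigr => i _; rewrite big_ord1 linearZ /= mxE /partial deriveE //.
by rewrite mulrC.
Qed.

(** Keeps the intermediate point of [mean_value] in the ball where the gradient is controlled. *)
Lemma segment_enorm (R : realType) (n : nat) (a x y : 'cV[R]_n) (t r : R) :
  0 <= t <= 1 -> enorm (x - a) <= r -> enorm (y - a) <= r ->
  enorm (x + t *: (y - x) - a) <= r.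
Proof.
move=> /andP[t0 t1] xr yr.
have -> : x + t *: (y - x) - a = (1 - t) *: (x - a) + t *: (y - a).
  by apply/colP => i; rewrite !mxE; ring.
apply: le_trans (enormD _ _) _.
rewrite !enormZ !ger0_norm ?subr_ge0 //.
have -> : r = (1 - t) * r + t * r by ring.
by apply: lerD; rewrite ler_wpM2l ?subr_ge0.
Qed.

Lemma mean_value (R : realType) (n : nat) (h : 'cV[R]_n -> R^o)
    (x y : 'cV[R]_n) : (forall z, differentiable h z) ->
  exists2 t : R, 0 <= t <= 1 &
    h y - h x = dot (grad h (x + t *: (y - x))) (y - x).
Proof.
move=> dh; pose d := y - x; pose phi (t : R) : R := h (x + t *: d).
have dphi (t : R) : is_derive t 1 (phi : R -> R^o) (dot (grad h (x + t *: d)) d).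
  (* The difference quotient of [phi] at [t] is that of [h] at x + t d in the direction d. *)
  have E : (fun s : R => s^-1 *: (phi (s *: 1 + t) - phi t)) =
           (fun s : R => s^-1 *: (h (s *: d + (x + t *: d)) - h (x + t *: d))).
    apply/funext => s; rewrite /phi /=; congr (_ *: (h _ - _)).
    by rewrite [s *: 1]mulr1 scalerDl addrCA.
  apply: DeriveDef.
    rewrite /derivable /= E; apply: diff_derivable; exact: dh.
  by rewrite /derive /= E -derive_grad.
have cphi : {within `[0, 1], continuous phi}.
  apply: continuous_subspaceT => t; apply: differentiable_continuous.
  by apply/derivable1_diffP; case: (dphi t).
have [t t01 e] := @MVT_segment R phi _ 0 1 ler01 (fun t _ => dphi t) cphi.
exists t; first by move: t01; rewrite in_itv.
by move: e; rewrite /phi scale1r scale0r addr0 subr0 mulr1 /d (addrC x) subrK.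
Qed.

Lemma cvg_grad (R : realType) (n : nat) (h : 'cV[R]_n -> R^o) (a : 'cV[R]_n) :
  continuously_differentiable h -> grad h x @[x --> a] --> grad h a.
Proof.
move=> [_ ch]; apply: (cvg_mx (F := nbhs a)) => i j; under eq_fun do rewrite mxE.
by rewrite mxE; exact: ch.
Qed.

(** By the mean value theorem the error is <grad h z - grad h a, y - x> for some z on the segment
    from x to y, and the gradient is continuous at [a]. *)
Lemma strictly_differentiable_scalar (R : realType) (n : nat)
    (h : 'cV[R]_n -> R^o) (a : 'cV[R]_n) (e : R) :
  continuously_differentiable h -> 0 < e ->
  \forall r \near (0 : R)^'+, forall x y,
    enorm (x - a) <= r -> enorm (y - a) <= r ->
    `|h y - h x - dot (grad h a) (y - x)| <= e * enorm (y - x).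
Proof.
move=> C1h e0.
have : \forall x \near a, forall u : 'cV[R]_n,
    enorm (((grad h x)^T - (grad h a)^T) *m u) <= e * enorm u.
  apply: (near_mulmx_le (F := nbhs a) (M := fun x => (grad h x)^T)) => //.
  by apply: cvg_trmx; exact: cvg_grad.
move=> /near_enorm_ball; apply: filterS => r near_a x y xr yr.
have [t t01 ->] := mean_value x y C1h.1.
have zr := segment_enorm t01 xr yr.
apply: le_trans (near_a _ zr (y - x)).
apply: le_trans (coord_le_enorm _ 0).
by rewrite mulmxBl !dotE !mxE.
Qed.

Lemma strictly_differentiable (R : realType) (n p : nat)
    (F : 'cV[R]_n -> 'cV[R]_p) (a : 'cV[R]_n) (e : R) :
  (forall i, continuously_differentiable (component F i)) -> 0 < e ->
  \forall r \near (0 : R)^'+, forall x y,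
    enorm (x - a) <= r -> enorm (y - a) <= r ->
    enorm (F y - F x - jac F a *m (y - x)) <= e * enorm (y - x).
Proof.
(* Dividing by p + 1 absorbs the factor p of [enorm_le_coord] and stays meaningful for p = 0. *)
move=> C1F e0; have e1 : 0 < e / p.+1%:R by rewrite divr_gt0.
have : \forall r \near (0 : R)^'+, forall i x y,
    enorm (x - a) <= r -> enorm (y - a) <= r ->
    `|component F i y - component F i x - dot (grad (component F i) a) (y - x)|
      <= e / p.+1%:R * enorm (y - x).
  by apply: filter_forall => i; exact: strictly_differentiable_scalar.
apply: filterS => r near_a x y xr yr.
apply: (@le_trans _ _ (p%:R * (e / p.+1%:R * enorm (y - x)))).
  apply: enorm_le_coord => i; apply: le_trans (near_a i x y xr yr).
  rewrite !mxE /component /dot le_eqVlt; apply/orP; left; apply/eqP.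
  by congr (`|_ - _|); apply: eq_bigr => j _; rewrite !mxE.
rewrite mulrA ler_wpM2r ?enorm_ge0 // mulrCA ler_piMr ?ltW //.
by rewrite mulrC ltr_pdivrMl // mulr1 ltr_nat.
Qed.

(** * Regularity of Jacobians, components and linear combinations *)

Lemma cvg_jac (R : realType) (n p : nat) (F : 'cV[R]_n -> 'cV[R]_p)
    (a : 'cV[R]_n) :
  (forall i, continuously_differentiable (component F i)) ->
  jac F x @[x --> a] --> jac F a.
Proof.
move=> C1F; apply: (cvg_mx (F := nbhs a)) => i j; under eq_fun do rewrite mxE.
by rewrite mxE; case: (C1F i) => _; exact.
Qed.

Lemma partial_component (R : realType) (n p : nat) (F : 'cV[R]_n -> 'cV[R]_p)
    (i : 'I_p) (j : 'I_n) : (forall x, differentiable F x) ->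
  partial j (component F i) = component (partial j F) i.
Proof.
move=> dF; apply/funext => x; rewrite /partial /component derive_mx ?mxE //.
exact: diff_derivable.
Qed.

Lemma component_C1 (R : realType) (n p : nat) (F : 'cV[R]_n -> 'cV[R]_p)
    (i : 'I_p) :
  continuously_differentiable F -> continuously_differentiable (component F i).
Proof.
move=> [dF cF]; split=> [x|j].
  exact: (differentiable_comp (dF x) (differentiable_coord _ i 0)).
rewrite partial_component // => x.
by apply: (cvg_coord (F := nbhs x) (M := partial j F)); exact: cF.
Qed.

Lemma component_C2 (R : realType) (n p : nat) (F : 'cV[R]_n -> 'cV[R]_p)
    (i : 'I_p) : twice_continuously_differentiable F ->
  twice_continuously_differentiable (component F i).
Proof.
move=> [C1F C2F]; split=> [|j]; first exact: component_C1.
by rewrite (partial_component i j C1F.1); apply: component_C1; exact: C2F.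
Qed.

Lemma partialD_scale (R : realType) (n : nat) (h k : 'cV[R]_n -> R^o) (a : R)
    (j : 'I_n) :
  (forall x, differentiable h x) -> (forall x, differentiable k x) ->
  partial j (fun x => h x + k x * a : R^o) =
  (fun x => partial j h x + partial j k x * a).
Proof.
move=> dh dk; apply/funext => x; rewrite /partial.
have -> : (fun x => h x + k x * a : R^o) = h + (a \*: k).
  by apply/funext => y; rewrite /= mulrC.
rewrite deriveD ?deriveZ; first by rewrite mulrC.
- exact: diff_derivable.
- exact: diff_derivable.
- by apply: derivableZ; exact: diff_derivable.
Qed.

Lemma C1D_scale (R : realType) (n : nat) (h k : 'cV[R]_n -> R^o) (a : R) :
  continuously_differentiable h -> continuously_differentiable k ->
  continuously_differentiable (fun x => h x + k x * a : R^o).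
Proof.
move=> [dh ch] [dk ck]; split=> [x|j].
  have -> : (fun x => h x + k x * a : R^o) = h + (a \*: k).
    by apply/funext => y; rewrite /= mulrC.
  by apply: differentiableD => //; exact: differentiableZ.
rewrite partialD_scale // => x.
apply: (@cvgD R R^o _ (nbhs x) _ (partial j h) (fun y => partial j k y * a)).
  exact: ch.
by apply: (@cvgM R _ (nbhs x) _ (partial j k) (fun=> a));
  [exact: ck|exact: cvg_cst].
Qed.

(** Induction on [r] with [h] generalized: the head term is absorbed into [h]. The order of the
    factors matches the entries of [nabla g x *m lam]. *)
Lemma C1_linear_combination (R : realType) (n : nat) (I : Type) (r : seq I)
    (h : 'cV[R]_n -> R^o) (k : I -> 'cV[R]_n -> R^o) (a : I -> R) :
  continuously_differentiable h ->
  (forall i, continuously_differentiable (k i)) ->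
  continuously_differentiable (fun x => h x + \sum_(i <- r) k i x * a i : R^o) /\
  forall j, partial j (fun x => h x + \sum_(i <- r) k i x * a i : R^o) =
    fun x => partial j h x + \sum_(i <- r) partial j (k i) x * a i.
Proof.
move=> C1h C1k; elim: r h C1h => [|i r IH] h C1h.
  have -> : (fun x => h x + \sum_(i <- [::]) k i x * a i : R^o) = h.
    by apply/funext => x; rewrite big_nil addr0.
  by split=> // j; apply/funext => x; rewrite big_nil addr0.
have -> : (fun x => h x + \sum_(j <- i :: r) k j x * a j : R^o) =
          (fun x => (h x + k i x * a i) + \sum_(j <- r) k j x * a j).
  by apply/funext => x; rewrite big_cons addrA.
have [C1s Ds] := IH _ (C1D_scale (a i) C1h (C1k i)).
split=> // j; rewrite Ds; apply/funext => x.
by rewrite partialD_scale ?big_cons ?addrA //; [case: C1h|case: (C1k i)].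
Qed.

(** * The linearized step *)

(** Row vectors are the setting of the compactness argument in [coercive_on_kernel]; two matrices
    let this lemma serve all three quadratic functions there. *)
Lemma continuous_quadratic (R : realType) (n p : nat) (M N : 'M[R]_(p, n)) :
  continuous (fun u : 'rV[R]_n => dot (M *m u^T) (N *m u^T) : R).
Proof.
under eq_fun do rewrite dotE; move=> u.
have cT : w^T @[w --> u] --> u^T by apply: (cvg_trmx (F := nbhs u)); exact: cvg_id.
have cM (Q : 'M[R]_(p, n)) : Q *m w^T @[w --> u] --> Q *m u^T.
  by apply: (cvg_mulmx (F := nbhs u) (M := fun=> Q)) => //; exact: cvg_cst.
apply: (cvg_coord (F := nbhs u) (M := fun w => (M *m w^T)^T *m (N *m w^T))).
apply: (cvg_mulmx (F := nbhs u)) => //.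
exact: (cvg_trmx (F := nbhs u)).
Qed.

(** The form attains a positive minimum [c] on the compact set of unit vectors of the kernel, and
    homogeneity extends the bound to the whole kernel. *)
Lemma coercive_on_kernel (R : realType) (m n : nat) (A : 'M[R]_(m, n))
    (H : 'M[R]_n) :
  (forall tau, A *m tau = 0 -> tau != 0 -> 0 < dot (H *m tau) tau) ->
  exists2 c : R, 0 < c &
    forall tau, A *m tau = 0 -> c * enorm tau ^+ 2 <= dot (H *m tau) tau.
Proof.
move=> Hpos.
pose q (u : 'rV[R]_n) : R := dot (H *m u^T) (1%:M *m u^T).
pose sq (u : 'rV[R]_n) : R := dot (1%:M *m u^T) (1%:M *m u^T).
pose Asq (u : 'rV[R]_n) : R := dot (A *m u^T) (A *m u^T).
pose K : set 'rV[R]_n := (Asq @^-1` [set 0]) `&` (sq @^-1` [set 1]).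
have Kcompact : compact K.
  apply: bounded_closed_compact.
    exists 1; split=> // e /ltW e1 u [_ /= su]; apply: le_trans _ e1.
    rewrite [leLHS]mx_normrE; apply: bigmax_le => // -[i j] _ /=.
    have := coord_le_enorm u^T j; rewrite mxE (ord1 i) => /le_trans; apply.
    by move: su; rewrite /sq mul1mx /enorm => ->; rewrite sqrtr1.
  apply: closedI.
    by apply: preimage_closed => [u _|];
      [exact: continuous_quadratic|exact: closed_eq].
  by apply: preimage_closed => [u _|];
    [exact: continuous_quadratic|exact: closed_eq].
have unit_in_K (tau : 'cV[R]_n) : A *m tau = 0 -> tau != 0 ->
    K ((enorm tau)^-1 *: tau)^T.
  move=> At t0; split; rewrite /= /Asq /sq trmxK.
    by rewrite -scalemxAr At scaler0 dotE mulmx0 mxE.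
  rewrite mul1mx dotZr dotC dotZr -sqr_enorm expr2.
  by rewrite mulKf ?mulVf // enorm_eq0.
(* If there is no unit vector in the kernel, the kernel is trivial and any positive constant
   works. *)
have [K0|K0] := pselect (K !=set0); last first.
  exists 1 => // tau At; have [->|t0] := eqVneq tau 0.
    by rewrite mulmx0 enorm0 dotE mulmx0 mxE expr0n mulr0.
  by case: K0; exists ((enorm tau)^-1 *: tau)^T;
    exact: unit_in_K.
have [] := @compact_EVT_min _ R q K K0 Kcompact.
  by apply: continuous_subspaceT; exact: continuous_quadratic.
move=> u /set_mem[/= /eqP Au su] umin; exists (q u).
  rewrite /q mul1mx; apply: Hpos.
    by move: Au; rewrite /Asq dot_eq0 => /eqP.
  apply: contra_eq_neq su => u0.
  by rewrite /sq mul1mx u0 dotE mulmx0 mxE eq_sym oner_eq0.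
move=> tau At; have [->|t0] := eqVneq tau 0.
  by rewrite mulmx0 enorm0 dotE mulmx0 mxE expr0n mulr0.
have et : enorm tau != 0 by rewrite enorm_eq0.
have := umin _ (mem_set (unit_in_K tau At t0)).
rewrite {2}/q trmxK mul1mx -scalemxAr dotZr dotC dotZr dotC mulrA -invfM -expr2.
by rewrite ler_pdivlMl ?exprn_even_gt0 // mulrC.
Qed.

(** * The pseudo-inverse and the tangent projection *)

Lemma mulmx_trmx_unit (R : realType) (m n : nat) (A : 'M[R]_(m, n)) :
  \rank A = m -> A *m A^T \in unitmx.
Proof.
move=> rA; rewrite -row_free_unit; apply/inj_row_free => u uAA.
(* The squared length of A^T u^T is <u^T, A A^T u^T>, which vanishes. *)
have uA : A^T *m u^T = 0.
  have uAAT : A *m A^T *m u^T = 0.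
    by have := congr1 trmx uAA; rewrite !trmx_mul trmxK trmx0.
  by apply/eqP; rewrite -dot_eq0 dot_mull trmxK mulmxA uAAT dotE mulmx0 mxE.
have : u *m A == 0 by rewrite -trmx_eq0 trmx_mul uA.
by rewrite mulmx_free_eq0 /row_free ?rA // => /eqP.
Qed.

(** The Moore-Penrose inverse when [A *m A^T] is invertible. *)
Definition right_pinv (R : realType) (m n : nat) (A : 'M[R]_(m, n)) :
  'M[R]_(n, m) := A^T *m invmx (A *m A^T).

(** The orthogonal projection onto the kernel of [A] when [A *m A^T] is invertible. *)
Definition tangent_proj (R : realType) (m n : nat) (A : 'M[R]_(m, n)) :
  'M[R]_n := 1%:M - right_pinv A *m A.

Lemma mulmx_right_pinv (R : realType) (m n : nat) (A : 'M[R]_(m, n)) :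
  A *m A^T \in unitmx -> A *m right_pinv A = 1%:M.
Proof. by move=> Au; rewrite mulmxA mulmxV. Qed.

Lemma tangent_projT (R : realType) (m n : nat) (A : 'M[R]_(m, n)) :
  (tangent_proj A)^T = tangent_proj A.
Proof.
rewrite /tangent_proj /right_pinv linearB /= trmx1 !trmx_mul trmxK.
by rewrite trmx_inv trmx_mul trmxK mulmxA.
Qed.

Lemma mulmx_tangent_proj (R : realType) (m n : nat) (A : 'M[R]_(m, n)) :
  A *m A^T \in unitmx -> A *m tangent_proj A = 0.
Proof.
by move=> Au; rewrite mulmxBr mulmx1 mulmxA mulmx_right_pinv // mul1mx subrr.
Qed.

(** Write v = tau + S A v with tau = P v in the kernel and S the pseudo-inverse. As P is symmetric,
    <v, P H^T v> = <H tau, tau> + <tau, H^T S A v>; the first term is coercive in tau, the second is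
    O(|v| |A v|). *)
Lemma coercive_tangent (R : realType) (m n : nat) (A : 'M[R]_(m, n))
    (H : 'M[R]_n) : A *m A^T \in unitmx ->
  (forall tau, A *m tau = 0 -> tau != 0 -> 0 < dot (H *m tau) tau) ->
  exists c C : R, [/\ 0 < c, 0 <= C & forall v,
    c * enorm v ^+ 2 - C * enorm (A *m v) * enorm v <=
      dot v (tangent_proj A *m (H^T *m v))].
Proof.
move=> Au /coercive_on_kernel[c c0 cH].
have [Cp Cp0 bP] := mulmx_bounded (tangent_proj A).
have [Cs Cs0 bS] := mulmx_bounded (right_pinv A).
have [Ch Ch0 bH] := mulmx_bounded (H^T *m right_pinv A).
(* [2 * c * Cs] is the cost of replacing |tau|^2 by |v|^2 ([h7]), [Cp * Ch] that of the cross term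
   ([h6]). *)
exists c, (2 * c * Cs + Cp * Ch).
split=> // [|v]; first by rewrite addr_ge0 ?mulr_ge0 // ltW.
pose tau := tangent_proj A *m v.
have vE : v = tau + right_pinv A *m (A *m v).
  by rewrite /tau mulmxBl mul1mx mulmxA subrK.
have At : A *m tau = 0 by rewrite mulmxA mulmx_tangent_proj // mul0mx.
have -> : dot v (tangent_proj A *m (H^T *m v)) =
    dot (H *m tau) tau + dot tau (H^T *m right_pinv A *m (A *m v)).
  rewrite dotC dot_mull tangent_projT -/tau dotC {1}vE.
  by rewrite mulmxDr dotDr dot_mull -!mulmxA.
have := dot_le_enorm tau (- (H^T *m right_pinv A *m (A *m v))).
rewrite enormN -scaleN1r dotZr mulN1r => h1.
have h2 := bH (A *m v); have h3 := cH _ At; have h4 := bP v.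
have h5 : enorm v <= enorm tau + Cs * enorm (A *m v).
  by rewrite {1}vE; apply: le_trans (enormD _ _) _; rewrite lerD2l.
have h6 : enorm tau * enorm (H^T *m right_pinv A *m (A *m v)) <=
    (Cp * enorm v) * (Ch * enorm (A *m v)) by rewrite ler_pM ?enorm_ge0.
have h7 : enorm v ^+ 2 - 2 * (Cs * enorm (A *m v)) * enorm v <= enorm tau ^+ 2.
  have z0 : 0 <= Cs * enorm (A *m v) by rewrite mulr_ge0 ?enorm_ge0.
  have v0 := enorm_ge0 v; have t0 := enorm_ge0 tau.
  set x := enorm tau in h5 t0 *; set y := enorm v in h5 v0 *.
  set z := Cs * _ in h5 z0 *.
  (* If y <= z, the left side y (y - 2 z) is nonpositive; otherwise 0 <= y - z <= x can be
     squared. *)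
  have [zy|yz] := leP y z; first by nra.
  nra.
have h8 := ler_wpM2l (ltW c0) h7.
move: h1 h3 h6 h8; rewrite /tau; lra.
Qed.

(** Expand |v - eta w|^2 with w = P H^T v: [coercive_tangent] bounds -2 eta <v, w>, and eta^2 |w|^2
    is absorbed for small eta. *)
Lemma tangent_step_le (R : realType) (m n : nat) (A : 'M[R]_(m, n))
    (H : 'M[R]_n) : A *m A^T \in unitmx ->
  (forall tau, A *m tau = 0 -> tau != 0 -> 0 < dot (H *m tau) tau) ->
  exists c C : R, [/\ 0 < c, 0 <= C & \forall eta \near 0^'+, forall v,
    enorm (v - eta *: (tangent_proj A *m (H^T *m v))) <=
      (1 - eta * c) * enorm v + eta * C * enorm (A *m v)].
Proof.
move=> Au /(coercive_tangent Au)[c [C [c0 C0 cC]]].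
have [b b0 bB] := mulmx_bounded (tangent_proj A *m H^T).
(* Of the gain 2 eta c |v|^2, half pays for eta^2 |w|^2. Doubling [C] makes the cross term of the
   squared right side, 4 eta C (1 - eta c / 2) |A v| |v|, at least the required 2 eta C |A v|
   |v|. *)
exists (c / 2), (2 * C); split; [lra|lra|].
have b1 : 0 < b ^+ 2 + 1 by rewrite ltr_wpDl // sqr_ge0.
have cb0 : 0 < c / (b ^+ 2 + 1) by rewrite divr_gt0.
have ci0 : 0 < c^-1 by rewrite invr_gt0.
near=> eta => v.
have eta0 : 0 < eta by [].
have etac : eta * c <= 1.
  rewrite -ler_pdivlMr // div1r; near: eta; exact: nbhs_right_le.
have etab : eta * b ^+ 2 <= c.
  have : eta * (b ^+ 2 + 1) <= c.
    rewrite -ler_pdivlMr //; near: eta; exact: nbhs_right_le.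
  by lra.
have := cC v; rewrite mulmxA; set w := tangent_proj A *m H^T *m v => h1.
have h2 : enorm w <= b * enorm v := bB v.
have v0 := enorm_ge0 v; have Av0 := enorm_ge0 (A *m v); have w0 := enorm_ge0 w.
rewrite -(ler_pXn2r (ltn0Sn 1)) ?nnegrE ?enorm_ge0 //; last first.
  apply: addr_ge0; apply: mulr_ge0 => //; first by lra.
  by rewrite !mulr_ge0 // ltW.
rewrite -scaleNr sqr_enormD dotZr enormZ normrN (ger0_norm (ltW eta0)) exprMn.
have h3 : enorm w ^+ 2 <= b ^+ 2 * enorm v ^+ 2.
  by rewrite -exprMn lerXn2r ?nnegrE ?mulr_ge0.
have h4 : eta ^+ 2 * enorm w ^+ 2 <= eta * c * enorm v ^+ 2.
  apply: (@le_trans _ _ (eta ^+ 2 * (b ^+ 2 * enorm v ^+ 2))).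
    by rewrite ler_wpM2l ?sqr_ge0.
  have := ler_wpM2l (mulr_ge0 (ltW eta0) (sqr_ge0 (enorm v))) etab.
  by rewrite expr2; lra.
have h5 := ler_wpM2l (ltW eta0) h1.
have h6 : 0 <= (1 - eta * c) * (eta * C * enorm (A *m v) * enorm v).
  by rewrite !mulr_ge0 ?subr_ge0 ?(ltW eta0).
have h7 := sqr_ge0 (eta * c * enorm v).
have h8 := sqr_ge0 (eta * C * enorm (A *m v)).
have h9 : 0 <= eta * C * enorm (A *m v) * enorm v.
  by rewrite !mulr_ge0 ?(ltW eta0).
move: h4 h5 h6 h7 h8 h9; set a := enorm v; set s := enorm (A *m v).
set d := dot v w; set q := enorm w; nra.
Unshelve. all: by end_near. Qed.

(** * The gradient of the Lagrangian *)

Definition lagrangian_grad (R : realType) (n m : nat) (f : 'cV[R]_n -> R^o)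
    (g : 'cV[R]_n -> 'cV[R]_m) (lam : 'cV[R]_m) (x : 'cV[R]_n) : 'cV[R]_n :=
  grad f x + nabla g x *m lam.

Lemma component_lagrangian_grad (R : realType) (n m : nat)
    (f : 'cV[R]_n -> R^o) (g : 'cV[R]_n -> 'cV[R]_m) (lam : 'cV[R]_m)
    (j : 'I_n) :
  component (lagrangian_grad f g lam) j =
  (fun x => partial j f x + \sum_(i < m) partial j (component g i) x * lam i 0).
Proof.
apply/funext => x; rewrite /component !mxE; congr (_ + _).
by apply: eq_bigr => i _; rewrite !mxE.
Qed.

Lemma lagrangian_grad_C1 (R : realType) (n m : nat) (f : 'cV[R]_n -> R^o)
    (g : 'cV[R]_n -> 'cV[R]_m) (lam : 'cV[R]_m) (j : 'I_n) :
  twice_continuously_differentiable f -> twice_continuously_differentiable g ->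
  continuously_differentiable (component (lagrangian_grad f g lam) j).
Proof.
move=> C2f C2g; rewrite component_lagrangian_grad.
apply: (proj1 (C1_linear_combination _ (fun i => lam i 0) (C2f.2 j) _)) => i.
exact: (component_C2 i C2g).2.
Qed.

(** The transpose reflects the index order: entry (i, j) of [hess] differentiates in j first and
    then in i, whereas row j of the Jacobian belongs to the partial derivative in j. *)
Lemma jac_lagrangian_grad (R : realType) (n m : nat) (f : 'cV[R]_n -> R^o)
    (g : 'cV[R]_n -> 'cV[R]_m) (lam : 'cV[R]_m) (x : 'cV[R]_n) :
  twice_continuously_differentiable f -> twice_continuously_differentiable g ->
  jac (lagrangian_grad f g lam) x = (lagrangian_hess f g lam x)^T.
Proof.
move=> C2f C2g; apply/matrixP => j k.
rewrite mxE component_lagrangian_grad.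
rewrite (proj2 (C1_linear_combination _ (fun i => lam i 0) (C2f.2 j) _)).
  rewrite !mxE summxE; congr (_ + _).
  by apply: eq_bigr => i _; rewrite !mxE mulrC.
by move=> i; exact: (component_C2 i C2g).2.
Qed.

(** * The iteration map *)

Definition multiplier (R : realType) (n m : nat) (f : 'cV[R]_n -> R^o)
    (g : 'cV[R]_n -> 'cV[R]_m) (eta : R) (x : 'cV[R]_n) : 'cV[R]_m :=
  invmx (jac g x *m nabla g x) *m (g x - eta *: (jac g x *m grad f x)).

(** A total function of [x], so that [iter] can produce the sequence; [multiplier_unique] ties it to
    the linear system where the Gram matrix is invertible. *)
Definition next_iterate (R : realType) (n m : nat) (f : 'cV[R]_n -> R^o)
    (g : 'cV[R]_n -> 'cV[R]_m) (eta : R) (x : 'cV[R]_n) : 'cV[R]_n :=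
  x - eta *: grad f x - nabla g x *m multiplier f g eta x.

Lemma multiplier_unique (R : realType) (n m : nat) (f : 'cV[R]_n -> R^o)
    (g : 'cV[R]_n -> 'cV[R]_m) (eta : R) (x : 'cV[R]_n) :
  jac g x *m (jac g x)^T \in unitmx ->
  unique (multiplier_system f g eta x) (multiplier f g eta x).
Proof.
move=> Au; split=> [|lam].
  by rewrite /multiplier_system mulmxA mulmxV // mul1mx.
by rewrite /multiplier => <-; rewrite mulmxA mulVmx // mul1mx.
Qed.

(* Replacing grad f by the gradient of the Lagrangian only changes the
   multiplier, because the tangent projection kills the columns of nabla g. *)
Lemma next_iterateE (R : realType) (n m : nat) (f : 'cV[R]_n -> R^o)
    (g : 'cV[R]_n -> 'cV[R]_m) (lam : 'cV[R]_m) (eta : R) (x : 'cV[R]_n) :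
  jac g x *m (jac g x)^T \in unitmx ->
  next_iterate f g eta x =
  x + (- (eta *: (tangent_proj (jac g x) *m lagrangian_grad f g lam x))
       - right_pinv (jac g x) *m g x).
Proof.
move=> Au; rewrite /next_iterate /multiplier /lagrangian_grad /nabla.
have PA : tangent_proj (jac g x) *m (jac g x)^T = 0.
  rewrite -[RHS]trmx0 -(mulmx_tangent_proj Au).
  by rewrite trmx_mul tangent_projT.
rewrite (mulmxDr (tangent_proj _)) (mulmxA (tangent_proj _)) PA mul0mx addr0.
rewrite /tangent_proj /right_pinv mulmxBl mul1mx.
have regroup (a b c d : 'cV[R]_n) : a - b - (c - d) = a + (- (b - d) - c).
  by apply/colP => i; rewrite !mxE; ring.
by rewrite !mulmxBr scalerBr -!scalemxAr !mulmxA regroup.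
Qed.

(** Compares the true step with the linearized one at the solution. In the factor of [e], [C] comes
    from replacing A v by [gx], [Ch + 1] from replacing [P] by [Ps], and [Cp] from replacing [phi]
    by Ht v. These errors sit in the tangential term, so each carries [eta]. *)
Lemma step_estimate (R : realType) (n m : nat) (A : 'M[R]_(m, n))
    (Ps P Ht : 'M[R]_n) (S : 'M[R]_(n, m)) (v phi : 'cV[R]_n) (gx : 'cV[R]_m)
    (eta e c C Ch Cp Cs : R) :
  0 <= eta -> 0 <= e <= 1 -> 0 <= C -> 0 <= Cp ->
  enorm (v - eta *: (Ps *m (Ht *m v))) <=
    (1 - eta * c) * enorm v + eta * C * enorm (A *m v) ->
  enorm (gx - A *m v) <= e * enorm v ->
  enorm (phi - Ht *m v) <= e * enorm v ->
  enorm (Ht *m v) <= Ch * enorm v ->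
  (forall u, enorm ((P - Ps) *m u) <= e * enorm u) ->
  (forall u, enorm (Ps *m u) <= Cp * enorm u) ->
  enorm (S *m gx) <= Cs * enorm gx ->
  let d := - (eta *: (P *m phi)) - S *m gx in
  enorm d <= eta * ((Cp + 1) * (Ch + 1)) * enorm v + Cs * enorm gx /\
  enorm (v + d) <= (1 - eta * c + eta * (e * (C + Ch + 1 + Cp))) * enorm v
                   + (eta * C + Cs) * enorm gx.
Proof.
move=> eta0 /andP[e0 e1] C0 Cp0 hv hg hphi hH hP hPs hS d.
have v0 := enorm_ge0 v.
have phi_le : enorm phi <= (Ch + 1) * enorm v.
  have := enormD (phi - Ht *m v) (Ht *m v); rewrite subrK; nra.
have dP_le : enorm ((P - Ps) *m phi) <= e * ((Ch + 1) * enorm v).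
  by apply: le_trans (hP phi) _; rewrite ler_wpM2l.
have phi0 := enorm_ge0 phi.
have PE : P *m phi = (P - Ps) *m phi + Ps *m phi by rewrite -mulmxDl subrK.
have P_le : enorm (P *m phi) <= (Cp + 1) * ((Ch + 1) * enorm v).
  have := enormD ((P - Ps) *m phi) (Ps *m phi); rewrite -PE.
  have := hPs phi; nra.
have Av_le : enorm (A *m v) <= enorm gx + e * enorm v.
  have := enormB gx (gx - A *m v); rewrite opprB addrC subrK; lra.
split.
  apply: le_trans (enormB _ _) _; apply: lerD => //.
  by rewrite enormN enormZ ger0_norm // -!mulrA ler_wpM2l.
have -> : v + d = (v - eta *: (Ps *m (Ht *m v)))
    - eta *: ((P - Ps) *m phi + Ps *m (phi - Ht *m v)) - S *m gx.
  rewrite /d PE mulmxBr.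
  move: (Ps *m (Ht *m v)) ((P - Ps) *m phi) (Ps *m phi) (S *m gx) => a b p q.
  by apply/colP => i; rewrite !mxE; ring.
apply: le_trans (enormB _ _) _.
have := enormB (v - eta *: (Ps *m (Ht *m v)))
  (eta *: ((P - Ps) *m phi + Ps *m (phi - Ht *m v))).
rewrite enormZ ger0_norm //.
have := enormD ((P - Ps) *m phi) (Ps *m (phi - Ht *m v)).
have := hPs (phi - Ht *m v).
have := ler_wpM2l Cp0 hphi.
have hA := ler_wpM2l (mulr_ge0 eta0 C0) Av_le.
set q := enorm ((P - Ps) *m phi + _) => h1 h2 h3.
have : eta * q <= eta * (e * ((Ch + 1) * enorm v) + Cp * (e * enorm v)).
  by rewrite ler_wpM2l //; lra.
lra.
Qed.

(** * The Lyapunov function *)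

(** Bounds the distance of the next iterate by the current Lyapunov value; this keeps that iterate
    in the ball where strict differentiability of [g] applies. *)
Lemma step_arith (R : realType) (eta e c C K Kd Cs M a b : R) :
  0 <= a -> 0 <= b -> 0 < eta -> eta <= 1 -> 0 <= C -> 0 < Cs -> 0 <= e ->
  0 <= Kd -> 0 <= c -> M = 2 * (C + Cs) -> e * (K + 2 * M * Kd) <= c / 2 ->
  (1 - eta * c + eta * (e * K)) * a + (eta * C + Cs) * b <= a + M * b.
Proof.
move=> a0 b0 eta0 eta1 C0 Cs0 e0 Kd0 c0 ME eK.
have M0 : 0 <= M by rewrite ME; lra.
have h1 := ler_wpM2l (mulr_ge0 C0 b0) eta1.
have h2 := ler_wpM2l (mulr_ge0 (ltW eta0) a0) eK.
have h3 : 0 <= eta * a * (e * (M * Kd)) by rewrite !mulr_ge0 // ltW.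
have h4 : 0 <= eta * a * c by rewrite !mulr_ge0 // ltW.
have h5 : 0 <= C * b by rewrite mulr_ge0.
have h6 : 0 <= Cs * b by rewrite mulr_ge0 // ltW.
have h7 : M * b = 2 * (C + Cs) * b by rewrite ME.
lra.
Qed.

(** The coefficient of [a] is at most 1 - eta c + eta c / 2 by the choice of [e]. That of [b] is at
    most M / 2 + M / 4, since C + Cs = M / 2 and 2 e Cs <= 1 / 4, and 3 / 4 <= 1 - eta c / 2. *)
Lemma lyapunov_arith (R : realType) (eta e c C K Kd Cs M a b a' b' dn : R) :
  0 <= a -> 0 <= b -> 0 < eta -> eta <= 1 -> eta * c <= 2^-1 -> 0 <= e ->
  0 <= C -> 0 < Cs -> M = 2 * (C + Cs) ->
  e * (K + 2 * M * Kd) <= c / 2 -> e * Cs <= 8^-1 ->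
  dn <= eta * Kd * a + Cs * b ->
  a' <= (1 - eta * c + eta * (e * K)) * a + (eta * C + Cs) * b ->
  b' <= 2 * e * dn ->
  a' + M * b' <= (1 - eta * (c / 2)) * (a + M * b).
Proof.
move=> a0 b0 eta0 eta1 etac e0 C0 Cs0 ME eK eCs hdn ha' hb'.
have M0 : 0 < M by rewrite ME; lra.
have h1 := ler_wpM2l (mulr_ge0 C0 b0) eta1.
have h2 := ler_wpM2l (mulr_ge0 (ltW eta0) a0) eK.
have h3 := ler_wpM2l (mulr_ge0 (ltW M0) b0) eCs.
have h4 := ler_wpM2l (mulr_ge0 (ltW M0) b0) etac.
have h5 := ler_wpM2l (ltW M0) hb'.
have h6 := ler_wpM2l (mulr_ge0 (ltW M0) e0) hdn.
have h7 : M * b = 2 * (C + Cs) * b by rewrite ME.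
lra.
Qed.

(** Collects all smallness requirements at one radius. For the pseudo-inverse the fixed tolerance 1
    yields a uniform bound near [xs]. *)
Lemma local_estimates (R : realType) (n m : nat) (f : 'cV[R]_n -> R^o)
    (g : 'cV[R]_n -> 'cV[R]_m) (xs : 'cV[R]_n) (lam : 'cV[R]_m) (e : R) :
  twice_continuously_differentiable f -> twice_continuously_differentiable g ->
  g xs = 0 -> grad f xs + nabla g xs *m lam = 0 ->
  jac g xs *m (jac g xs)^T \in unitmx -> 0 < e ->
  \forall r \near (0 : R)^'+, forall x, enorm (x - xs) <= r ->
    [/\ jac g x *m (jac g x)^T \in unitmx,
        forall u, enorm ((tangent_proj (jac g x) - tangent_proj (jac g xs)) *m u)
          <= e * enorm u,
        forall u, enorm ((right_pinv (jac g x) - right_pinv (jac g xs)) *m u)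
          <= 1 * enorm u,
        forall u, enorm ((jac g x - jac g xs) *m u) <= e * enorm u &
        enorm (lagrangian_grad f g lam x
               - (lagrangian_hess f g lam xs)^T *m (x - xs))
          <= e * enorm (x - xs) /\
        forall y, enorm (y - xs) <= r ->
          enorm (g y - g x - jac g xs *m (y - x)) <= e * enorm (y - x)].
Proof.
move=> C2f C2g gxs kkt Au e0.
have C1g i : continuously_differentiable (component g i).
  by have [] := component_C2 i C2g.
have cA : jac g x @[x --> xs] --> jac g xs by exact: cvg_jac.
have cAT : (jac g x)^T @[x --> xs] --> (jac g xs)^T.
  exact: (cvg_trmx (F := nbhs xs)).
have cN : jac g x *m (jac g x)^T @[x --> xs] --> jac g xs *m (jac g xs)^T.
  exact: (cvg_mulmx (F := nbhs xs)).
have cS : right_pinv (jac g x) @[x --> xs] --> right_pinv (jac g xs).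
  apply: (cvg_mulmx (F := nbhs xs)) => //.
  exact: (cvg_invmx (F := nbhs xs)).
have cP : tangent_proj (jac g x) @[x --> xs] --> tangent_proj (jac g xs).
  apply: (@cvgB _ _ _ (nbhs xs)); first exact: cvg_cst.
  exact: (cvg_mulmx (F := nbhs xs)).
have nu := near_enorm_ball (near_unitmx (FF := nbhs_filter xs) Au cN).
have nP := near_enorm_ball (near_mulmx_le (FF := nbhs_filter xs) e0 cP).
have nS := near_enorm_ball (near_mulmx_le (FF := nbhs_filter xs) ltr01 cS).
have nA := near_enorm_ball (near_mulmx_le (FF := nbhs_filter xs) e0 cA).
have ng := strictly_differentiable xs C1g e0.
have nL := strictly_differentiable xs
  (fun j => lagrangian_grad_C1 lam j C2f C2g) e0.
near=> r => x xr; split.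
- by move: x xr; near: r.
- by move: x xr; near: r.
- by move: x xr; near: r.
- by move: x xr; near: r.
split=> [|y yr]; last by move: x y xr yr; near: r.
have r0 : 0 <= r by apply: le_trans xr; exact: enorm_ge0.
have hL : forall x y, enorm (x - xs) <= r -> enorm (y - xs) <= r ->
    enorm (lagrangian_grad f g lam y - lagrangian_grad f g lam x
           - jac (lagrangian_grad f g lam) xs *m (y - x)) <= e * enorm (y - x).
  by near: r.
(* Strict differentiability is used from the base point [xs], where the Lagrangian gradient vanishes
   by the KKT condition. *)
have := hL xs x; rewrite {1}/lagrangian_grad [X in _ - X - _]kkt.
rewrite subr0 jac_lagrangian_grad //.
by apply => //; rewrite subrr enorm0.
Unshelve. all: by end_near. Qed.

(** The constants are chosen in the order [M], [e], [r], [eta]. The contraction is stated on a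
    sublevel set of the Lyapunov function, which the iteration preserves; [B] serves to fit a ball
    of starting points into it. *)
Lemma lyapunov_contraction (R : realType) (n m : nat) (f : 'cV[R]_n -> R^o)
    (g : 'cV[R]_n -> 'cV[R]_m) (xs : 'cV[R]_n) (lam : 'cV[R]_m) :
  twice_continuously_differentiable f -> twice_continuously_differentiable g ->
  g xs = 0 -> grad f xs + nabla g xs *m lam = 0 ->
  jac g xs *m (jac g xs)^T \in unitmx ->
  (forall tau : 'cV[R]_n, jac g xs *m tau = 0 -> tau != 0 ->
     0 < dot (lagrangian_hess f g lam xs *m tau) tau) ->
  exists c M B r : R, [/\ 0 < c, 0 < M, 0 <= B & 0 < r] /\
    [/\ (forall x, enorm (x - xs) <= r ->
      jac g x *m (jac g x)^T \in unitmx /\ enorm (g x) <= B * enorm (x - xs)) &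
    \forall eta \near 0^'+, forall x,
      enorm (x - xs) + M * enorm (g x) <= r ->
      enorm (next_iterate f g eta x - xs) + M * enorm (g (next_iterate f g eta x))
        <= (1 - eta * c) * (enorm (x - xs) + M * enorm (g x))].
Proof.
move=> C2f C2g gxs kkt Au pos.
have [c [C [c0 C0 hstep]]] := tangent_step_le Au pos.
set A := jac g xs in Au hstep *; set Ht := (lagrangian_hess _ _ _ _)^T in hstep.
have [B B0 bA] := mulmx_bounded A.
have [Ch Ch0 bH] := mulmx_bounded Ht.
have [Cp Cp0 bP] := mulmx_bounded (tangent_proj A).
have [Cs' Cs'0 bS'] := mulmx_bounded (right_pinv A).
pose Cs := Cs' + 1; have Cs0 : 0 < Cs by rewrite ltr_wpDl.
pose M := 2 * (C + Cs); have M0 : 0 < M by rewrite mulr_gt0 // ltr_wpDl.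
pose K := C + Ch + 1 + Cp; pose Kd := (Cp + 1) * (Ch + 1).
have Kd0 : 0 <= Kd by rewrite mulr_ge0 ?addr_ge0.
have K0 : 0 < K + 2 * M * Kd.
  apply: ltr_wpDr; first by apply: mulr_ge0 => //; rewrite mulr_ge0 ?ltW.
  by rewrite /K; lra.
(* The last two bounds are those required by [lyapunov_arith]. *)
have [e [e0 e1 eK eCs]] : exists e : R,
    [/\ 0 < e, e <= 1, e * (K + 2 * M * Kd) <= c / 2 & e * Cs <= 8^-1].
  have c2K : 0 < c / 2 / (K + 2 * M * Kd) by apply: divr_gt0 => //; exact: divr_gt0.
  have e8 : 0 < 8^-1 / Cs :> R by rewrite divr_gt0.
  near (0 : R)^'+ => e; exists e; split=> //.
  - by near: e; exact: nbhs_right_le.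
  - by rewrite -ler_pdivlMr //; near: e; exact: nbhs_right_le.
  - by rewrite -ler_pdivlMr //; near: e; exact: nbhs_right_le.
have [r [r0 hr]] := filter_ex (filterI (nbhs_right_gt 0)
  (local_estimates C2f C2g gxs kkt Au e0)).
have g_lin x : enorm (x - xs) <= r ->
    enorm (g x - A *m (x - xs)) <= e * enorm (x - xs).
  move=> xr; have xsr : enorm (xs - xs) <= r by rewrite subrr enorm0 ltW.
  by have [_ _ _ _ [_ /(_ _ xr)]] := hr xs xsr; rewrite gxs subr0.
exists (c / 2), M, (B + 1), r; split.
  by split=> //; [rewrite divr_gt0|rewrite addr_ge0].
split.
  move=> x xr; split; first by have [] := hr x xr.
  have := enormD (g x - A *m (x - xs)) (A *m (x - xs)); rewrite subrK.
  have := g_lin x xr; have := bA (x - xs); have := enorm_ge0 (x - xs); nra.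
have c2 : 0 < 2^-1 / c by rewrite divr_gt0.
near=> eta => x.
have eta0 : 0 < eta by [].
have eta1 : eta <= 1 by near: eta; exact: nbhs_right_le.
have etac : eta * c <= 2^-1.
  by rewrite -ler_pdivlMr //; near: eta; exact: nbhs_right_le.
set a := enorm (x - xs); set b := enorm (g x) => Wr.
have a0 : 0 <= a := enorm_ge0 _; have b0 : 0 <= b := enorm_ge0 _.
have xr : a <= r by apply: le_trans Wr; rewrite lerDl mulr_ge0 // ltW.
have [Axu hP hS hA [hphi hstrict]] := hr x xr.
have bS : enorm (right_pinv (jac g x) *m g x) <= Cs * b.
  have -> : right_pinv (jac g x) *m g x =
      right_pinv A *m g x + (right_pinv (jac g x) - right_pinv A) *m g x.
    by rewrite -mulmxDl addrC subrK.
  by apply: le_trans (enormD _ _) _; rewrite /Cs mulrDl; exact: lerD.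
have hv : enorm ((x - xs) - eta *: (tangent_proj A *m (Ht *m (x - xs)))) <=
    (1 - eta * c) * a + eta * C * enorm (A *m (x - xs)).
  by rewrite /a; move: (x - xs); near: eta.
have e01 : 0 <= e <= 1 by rewrite e1 ltW.
have [] := step_estimate (ltW eta0) e01 C0 Cp0 hv (g_lin x xr) hphi (bH _) hP
  bP bS.
set d := - _ - _; rewrite -/a -/b -/K -/Kd => hd.
have nextE : next_iterate f g eta x = x + d by exact: next_iterateE.
have -> : x - xs + d = next_iterate f g eta x - xs by rewrite nextE addrAC.
move=> ha'.
have a'r : enorm (next_iterate f g eta x - xs) <= r.
  apply: le_trans ha' _; apply: le_trans Wr.
  exact: (step_arith a0 b0 eta0 eta1 C0 Cs0 (ltW e0) Kd0 (ltW c0) (erefl M) eK).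
have Ad : jac g x *m d = - g x.
  rewrite /d mulmxBr mulmxN -scalemxAr mulmxA mulmx_tangent_proj // mulmxA.
  by rewrite mulmx_right_pinv // mul0mx mul1mx scaler0 oppr0 sub0r.
have hb' : enorm (g (next_iterate f g eta x)) <= 2 * e * enorm d.
  (* Since A(x) d = - g(x), the new constraint value is the linearization error at [xs] minus (A(x)
     - A) d; each part costs [e] times |d|. *)
  have -> : g (next_iterate f g eta x) =
      (g (next_iterate f g eta x) - g x - A *m (next_iterate f g eta x - x))
      - (jac g x - A) *m d.
    by rewrite {3}nextE (addrC x) addrK mulmxBl Ad opprB opprK addrA !subrK.
  apply: le_trans (enormB _ _) _; rewrite mulr2n !mulrDl !mul1r.
  apply: lerD; last exact: hA.
  have -> : d = next_iterate f g eta x - x by rewrite nextE (addrC x) addrK.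
  exact: hstrict.
exact: (lyapunov_arith a0 b0 eta0 eta1 etac (ltW e0) C0 Cs0 (erefl M) eK eCs
  hd ha' hb').
Unshelve. all: by end_near. Qed.

(** * Linear convergence of the iterates *)

Theorem theorem3 (R : realType) (m n : nat) (m_gt0 : (0 < m)%N)
    (lt_mn : (m < n)%N)
    (f : 'cV[R]_n -> R^o) (g : 'cV[R]_n -> 'cV[R]_m)
    (f_C2 : twice_continuously_differentiable f)
    (g_C2 : twice_continuously_differentiable g)
    (xs : 'cV[R]_n) (g_xs : g xs = 0)
    (regular : \rank (jac g xs) = m)
    (lams : 'cV[R]_m)
    (kkt : grad f xs + nabla g xs *m lams = 0)
    (pos_def : forall tau : 'cV[R]_n, jac g xs *m tau = 0 -> tau != 0 ->
       0 < dot (lagrangian_hess f g lams xs *m tau) tau) :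
  exists r : R, 0 < r /\
    \forall eta \near 0^'+,
      forall x0 : 'cV[R]_n, enorm (x0 - xs) <= r ->
        exists (x : nat -> 'cV[R]_n) (lam : nat -> 'cV[R]_m),
          iterates f g eta x0 x lam /\ converges_linearly x xs.
Proof.
have [c [M [B [rho [[c0 M0 B0 rho0] [near_xs hstep]]]]]] :=
  lyapunov_contraction f_C2 g_C2 g_xs kkt (mulmx_trmx_unit regular) pos_def.
have MB0 : 0 <= M * B by rewrite mulr_ge0 // ltW.
have MB1 : 0 < 1 + M * B by rewrite ltr_wpDr.
(* On this ball |x - xs| + M |g x| <= (1 + M B) |x - xs| <= rho. *)
exists (rho / (1 + M * B)); split; first by rewrite divr_gt0.
have c1 : 0 < 1 / c by rewrite divr_gt0.
near=> eta => x0 x0r.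
have eta0 : 0 < eta by [].
have etac : eta * c < 1.
  by rewrite -ltr_pdivlMr //; near: eta; exact: nbhs_right_lt.
pose L := 1 - eta * c.
have etac0 : 0 < eta * c by rewrite mulr_gt0.
have L01 : 0 < L < 1 by rewrite /L; lra.
pose W x := enorm (x - xs) + M * enorm (g x).
have W_ge x : enorm (x - xs) <= W x.
  by rewrite lerDl mulr_ge0 ?enorm_ge0 // ltW.
have WL x : W x <= rho -> W (next_iterate f g eta x) <= L * W x.
  by rewrite /W /L; move: x; near: eta.
pose x k := iter k (next_iterate f g eta) x0.
have W0 : W x0 <= rho.
  have x0rho : enorm (x0 - xs) <= rho.
    apply: le_trans x0r _.
    by rewrite ler_pdivrMr // ler_peMr ?(ltW rho0) // lerDl.
  have [_ gx0] := near_xs x0 x0rho.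
  move: x0r; rewrite ler_pdivlMr // /W => x0r.
  have := ler_wpM2l (ltW M0) gx0; lra.
have W_ge0 y : 0 <= W y := le_trans (enorm_ge0 _) (W_ge y).
(* Decay and confinement are proved together, because [WL] applies only inside the sublevel set. *)
have Wx k : W (x k) <= L ^+ k * W x0 /\ W (x k) <= rho.
  elim: k => [|k [IHL IHrho]]; first by rewrite expr0 mul1r.
  have [L0 L1] := andP L01; have h := WL _ IHrho; split.
    by apply: le_trans h _; rewrite exprS -mulrA ler_wpM2l // ltW.
  apply: le_trans h _; apply: le_trans IHrho.
  by rewrite ler_piMl ?(ltW L1).
exists x, (fun k => multiplier f g eta (x k)); split.
  split=> // k; apply: multiplier_unique.
  by have [] := near_xs (x k) (le_trans (W_ge _) (Wx k).2).
(* The added 1 keeps the constant positive when x0 = xs. *)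
exists L; split=> //; apply/eqO_exP; exists (W x0 + 1); first exact: ltr_wpDl.
apply: nearW => k /=.
have L0 : 0 <= L ^+ k by rewrite exprn_ge0 //; case/andP: L01 => /ltW.
rewrite !ger0_norm ?enorm_ge0 //.
apply: le_trans (W_ge _) _; apply: le_trans (Wx k).1 _.
by rewrite mulrC ler_wpM2r // lerDl.
Unshelve. all: by end_near. Qed.
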